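(* Let $X$ be a finite set with a transitive action of a finite group $G$, let $\pi$ be the induced permutation representation of $G$ on $\mathcal H_X$, and let $\mathcal T$ be the commutant of $\pi(G)$. If $T\in\mathcal T$, then for any $x_0\in X$, \[\|T\|_m=\|S_T|_{\mathcal T}\|=|X|^{-1}\operatorname{Tr}(|T|)=\langle|T|e_{x_0},e_{x_0}\rangle.\]
   Context: $\mathcal H_X$ is the Hilbert space with orthonormal basis $\{e_x:x\in X\}$, and $\pi(g)e_x=e_{gx}$. For a matrix $T=[t_{xy}]$, $S_T$ is the Schur multiplier $R=[r_{xy}]\mapsto[t_{xy}r_{xy}]$ on $\mathcal B(\mathcal H_X)$, $\|T\|_m$ is its norm, and $\|S_T|_{\mathcal T}\|$ is the norm of its restriction to $\mathcal T$ (with the operator norm). $|T|=(T^*T)^{1/2}$. *)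

(* Defs.v *)
From HB Require Import structures.
From mathcomp Require Import all_boot all_order all_fingroup all_algebra.
From mathcomp Require Import complex.
From mathcomp Require Import boolp classical_sets reals.
Set Implicit Arguments. Unset Strict Implicit. Unset Printing Implicit Defensive.
Import Order.TTheory GRing.Theory Num.Theory.
Local Open Scope ring_scope.
Local Open Scope classical_set_scope.

(* Operators on H_X = C^X (basis e_x, x in X) are represented by their
   matrices [t_xy] indexed by X x X. *)
Definition mxX (R : realType) (X : finType) := X -> X -> R[i].
Definition vecX (R : realType) (X : finType) := X -> R[i].

Definition mulX (R : realType) (X : finType) (A B : mxX R X) : mxX R X :=
  fun x y => \sum_(z : X) A x z * B z y.
Definition applyX (R : realType) (X : finType) (A : mxX R X) (v : vecX R X)
  : vecX R X := fun x => \sum_(y : X) A x y * v y.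
Definition adjX (R : realType) (X : finType) (A : mxX R X) : mxX R X :=
  fun x y => conjc (A y x).
Definition traceX (R : realType) (X : finType) (A : mxX R X) : R[i] :=
  \sum_(x : X) A x x.

Definition vnorm (R : realType) (X : finType) (v : vecX R X) : R :=
  Num.sqrt (\sum_(x : X) ComplexField.Normc.normc (v x) ^+ 2).
Definition opnorm (R : realType) (X : finType) (A : mxX R X) : R :=
  sup [set r : R | exists v : vecX R X, vnorm v <= 1 /\ r = vnorm (applyX A v)].

Definition schur (R : realType) (X : finType) (T Rm : mxX R X) : mxX R X :=
  fun x y => T x y * Rm x y.
Definition schur_norm (R : realType) (X : finType) (T : mxX R X) : R :=
  sup [set r : R | exists Rm : mxX R X, opnorm Rm <= 1 /\ r = opnorm (schur T Rm)].
Definition schur_norm_on (R : realType) (X : finType) (S : mxX R X -> Prop)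
  (T : mxX R X) : R :=
  sup [set r : R | exists Rm : mxX R X,
         S Rm /\ opnorm Rm <= 1 /\ r = opnorm (schur T Rm)].

(* Permutation representation: pi(g) e_y = e_{g.y}; matrix entry (x,y) is [x == g.y]. *)
Definition permrep (R : realType) (gT : finGroupType) (G : {set gT}) (X : finType)
  (to : action G X) (g : gT) : mxX R X :=
  fun x y => (x == to y g)%:R.

Definition commutant (R : realType) (gT : finGroupType) (G : {set gT}) (X : finType)
  (to : action G X) (A : mxX R X) : Prop :=
  forall g, g \in G -> mulX A (@permrep R _ _ _ to g) = mulX (@permrep R _ _ _ to g) A.

(* Positive semidefinite operators, and |T| = (T^* T)^{1/2} characterised as the
   (unique) positive semidefinite square root of T^* T. *)
Definition psd (R : realType) (X : finType) (P : mxX R X) : Prop :=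
  (forall x y, P x y = conjc (P y x)) /\
  (forall v : vecX R X, 0 <= \sum_(x : X) \sum_(y : X) conjc (v x) * P x y * v y).
Definition is_absmx (R : realType) (X : finType) (T P : mxX R X) : Prop :=
  psd P /\ mulX P P = mulX (adjX T) T.

(* Main.v *)
(** Let [P = |T|] and [T = U P] be the polar decomposition. Both [U] and [P] lie
    in the commutant, so by transitivity the diagonals of [P] and [U P U^*] are
    constant, and having equal traces they equal the same constant [c].
    Factoring [T = (U P^{1/2}) P^{1/2}], the rows of the first factor and the
    columns of the second have squared norm [c], which bounds the norm of the
    Schur multiplier by [c]. Conversely the entrywise conjugate of [U] is a
    contraction in the commutant whose Schur product with [T] maps the constant
    vector to [c] times itself. *)
Require Import Defs.
From HB Require Import structures.
From mathcomp Require Import all_boot all_order all_fingroup all_algebra.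
From mathcomp Require Import complex.
From mathcomp Require Import boolp classical_sets reals.
From mathcomp Require Import sesquilinear spectral.
Set Implicit Arguments. Unset Strict Implicit. Unset Printing Implicit Defensive.
Import Order.TTheory GRing.Theory Num.Theory.
Local Open Scope ring_scope.

(** * Matrices indexed by [X]: products, adjoints, diagonals, trace *)

Section OperatorAlgebra.
Context {R : realType} {X : finType}.
Implicit Types (A B : mxX R X) (v : vecX R X) (f g : X -> R[i]).

Definition idX : mxX R X := fun x y => (x == y)%:R.
Definition diagX f : mxX R X := fun x y => (x == y)%:R * f x.

Lemma mxX_eq A B : (forall x y, A x y = B x y) -> A = B.
Proof. by move=> AB; apply/funext=> x; apply/funext=> y. Qed.

Lemma sum_deltal x f : \sum_y (x == y)%:R * f y = f x.
Proof.
rewrite (bigD1 x) //= eqxx mul1r big1 ?addr0 // => y.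
by rewrite eq_sym => /negPf ->; rewrite mul0r.
Qed.

Lemma sum_deltar x f : \sum_y f y * (y == x)%:R = f x.
Proof. by rewrite -[RHS]sum_deltal; apply: eq_bigr => y _; rewrite mulrC eq_sym. Qed.

Lemma mulXA A B C : mulX A (mulX B C) = mulX (mulX A B) C.
Proof.
apply: mxX_eq => x y; rewrite /mulX.
under eq_bigr do rewrite mulr_sumr.
rewrite exchange_big /=; apply: eq_bigr => z _.
by rewrite mulr_suml; apply: eq_bigr => t _; rewrite mulrA.
Qed.

Lemma mul1X A : mulX idX A = A.
Proof. by apply: mxX_eq => x y; rewrite /mulX sum_deltal. Qed.

Lemma mulX1 A : mulX A idX = A.
Proof. by apply: mxX_eq => x y; rewrite /mulX sum_deltar. Qed.

Lemma mul_diagX f A x y : mulX (diagX f) A x y = f x * A x y.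
Proof.
rewrite /mulX /diagX.
under eq_bigr do rewrite -mulrA.
exact: sum_deltal.
Qed.

Lemma mulX_diag A f x y : mulX A (diagX f) x y = A x y * f y.
Proof.
rewrite /mulX /diagX.
under eq_bigr do rewrite mulrA mulrAC.
by rewrite sum_deltar.
Qed.

Lemma diagXM f g : mulX (diagX f) (diagX g) = diagX (fun x => f x * g x).
Proof. by apply: mxX_eq => x y; rewrite mul_diagX /diagX mulrCA. Qed.

Lemma adjXK A : adjX (adjX A) = A.
Proof. by apply: mxX_eq => x y; rewrite /adjX conjcK. Qed.

Lemma adjXM A B : adjX (mulX A B) = mulX (adjX B) (adjX A).
Proof.
apply: mxX_eq => x y; rewrite /adjX /mulX rmorph_sum /=.
by apply: eq_bigr => z _; rewrite rmorphM mulrC.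
Qed.

Lemma adjX_diag f : adjX (diagX f) = diagX (fun x => conjc (f x)).
Proof.
apply: mxX_eq => x y; rewrite /adjX /diagX rmorphM rmorph_nat eq_sym.
by case: eqP => [->|] //; rewrite !mul0r.
Qed.

Lemma traceXC A B : traceX (mulX A B) = traceX (mulX B A).
Proof.
rewrite /traceX /mulX exchange_big /=.
by do 2![apply: eq_bigr => ? _]; rewrite mulrC.
Qed.

(** * Squared norms and Cauchy-Schwarz *)

Definition sqn v : R := \sum_x ComplexField.Normc.normc (v x) ^+ 2.

Lemma sqn_ge0 v : 0 <= sqn v.
Proof. by apply: sumr_ge0 => x _; rewrite sqr_ge0. Qed.

Lemma normC_normc (z : R[i]) : `|z| = ((ComplexField.Normc.normc z)%:C)%C.
Proof. by []. Qed.

Lemma normc_ge0 (z : R[i]) : 0 <= ComplexField.Normc.normc z.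
Proof. by rewrite -ler0c -normC_normc normr_ge0. Qed.

Lemma normc_sqr (z : R[i]) :
  ((ComplexField.Normc.normc z ^+ 2)%:C)%C = conjc z * z.
Proof. by rewrite mulrC -sqr_normc rmorphXn. Qed.

Lemma sqnE v : ((sqn v)%:C)%C = \sum_x conjc (v x) * v x.
Proof. by rewrite rmorph_sum; apply: eq_bigr => x _; rewrite /= normc_sqr. Qed.

Lemma sqn_col A y : ((sqn (A ^~ y))%:C)%C = mulX (adjX A) A y y.
Proof. by rewrite sqnE. Qed.

Lemma sqn_row A x : ((sqn (A x))%:C)%C = mulX A (adjX A) x x.
Proof. by rewrite sqnE; apply: eq_bigr => z _; rewrite mulrC. Qed.

(** The diagonal entries of [A^* A] are the squared norms of the columns of [A]. *)
Lemma adj_mul_eq0 A : mulX (adjX A) A = (fun _ _ => 0) -> A = fun _ _ => 0.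
Proof.
move=> A0; apply: mxX_eq => x y.
have := sqn_col A y; rewrite A0 => /complexI /eqP.
rewrite psumr_eq0 => [/allP /(_ x (mem_index_enum _))|z _]; last exact: sqr_ge0.
by rewrite sqrf_eq0 => /eqP /ComplexField.Normc.eq0_normc.
Qed.

Lemma sqn_apply A v :
  ((sqn (applyX A v))%:C)%C = \sum_x \sum_y conjc (v x) * mulX (adjX A) A x y * v y.
Proof.
rewrite sqnE /applyX /mulX /adjX.
under eq_bigr => z _ do rewrite rmorph_sum /= mulr_suml.
rewrite exchange_big /=; apply: eq_bigr => x _.
under eq_bigr => z _ do rewrite mulr_sumr.
rewrite exchange_big /=; apply: eq_bigr => y _.
rewrite mulr_sumr mulr_suml; apply: eq_bigr => z _.
by rewrite rmorphM !mulrA [conjc (v x) * _]mulrC.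
Qed.

(** Pythagoras: with [B] a complementary projection, this makes the partial isometry of a polar
    decomposition a contraction. *)
Lemma sqn_applyD A B v :
  (forall x y, mulX (adjX A) A x y + mulX (adjX B) B x y = idX x y) ->
  sqn (applyX A v) + sqn (applyX B v) = sqn v.
Proof.
move=> AB; apply: complexI; rewrite rmorphD /= !sqn_apply -big_split /= sqnE.
apply: eq_bigr => x _; rewrite -big_split /=.
under eq_bigr => y _ do rewrite -mulrDl -mulrDr AB.
under eq_bigr do rewrite -mulrA.
by rewrite -mulr_sumr sum_deltal.
Qed.

(** Lagrange's identity: the defect is half the sum over pairs of [(a x * b y - a y * b x) ^+ 2]. *)
Lemma cauchy_schwarz_real (a b : X -> R) :
  (\sum_x a x * b x) ^+ 2 <= (\sum_x a x ^+ 2) * (\sum_x b x ^+ 2).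
Proof.
rewrite -subr_ge0.
suff -> : (\sum_x a x ^+ 2) * (\sum_x b x ^+ 2) - (\sum_x a x * b x) ^+ 2 =
    2^-1 * \sum_x \sum_y (a x * b y - a y * b x) ^+ 2.
  rewrite mulr_ge0 ?invr_ge0 ?ler0n //.
  by do 2!(apply: sumr_ge0 => ? _); rewrite sqr_ge0.
have e2 : \sum_x \sum_y (a x * b y) ^+ 2 = (\sum_x a x ^+ 2) * (\sum_x b x ^+ 2).
  rewrite mulr_suml; apply: eq_bigr => x _.
  by rewrite mulr_sumr; apply: eq_bigr => y _; rewrite exprMn.
have e3 : \sum_x \sum_y (a x * b y) * (a y * b x) = (\sum_x a x * b x) ^+ 2.
  rewrite expr2 mulr_suml; apply: eq_bigr => x _.
  rewrite mulr_sumr; apply: eq_bigr => y _.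
  by rewrite mulrACA [b y * _]mulrC mulrACA.
have -> : \sum_x \sum_y (a x * b y - a y * b x) ^+ 2 =
   2 * ((\sum_x a x ^+ 2) * (\sum_x b x ^+ 2) - (\sum_x a x * b x) ^+ 2).
  rewrite -e3 -e2 mulr_natl mulr2n.
  under eq_bigr => x _ do under eq_bigr => y _ do rewrite sqrrB.
  under eq_bigr do rewrite big_split /= sumrB.
  rewrite big_split /= sumrB [X in _ + X = _]exchange_big /=.
  under [X in _ - X + _ = _]eq_bigr do rewrite sumrMnl.
  by rewrite sumrMnl mulr2n opprD addrACA addrAC addrA.
by rewrite mulrA mulVf ?mul1r // pnatr_eq0.
Qed.

Lemma cauchy_schwarz v w :
  ComplexField.Normc.normc (\sum_x v x * w x) ^+ 2 <= sqn v * sqn w.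
Proof.
apply: le_trans (cauchy_schwarz_real _ _).
rewrite ler_sqr ?nnegrE; first last.
- by apply: sumr_ge0 => x _; rewrite mulr_ge0 ?normc_ge0.
- exact: normc_ge0.
rewrite -lecR rmorph_sum -normC_normc.
apply: le_trans (ler_norm_sum _ _ _) _.
by apply: ler_sum => x _; rewrite normC_normc ComplexField.Normc.normcM.
Qed.


Lemma vnormE v : vnorm v = Num.sqrt (sqn v). Proof. by []. Qed.

Lemma vnorm_le v (c : R) : 0 <= c -> (vnorm v <= c) = (sqn v <= c ^+ 2).
Proof.
move=> c0; rewrite vnormE -{1}(ger0_norm c0) -sqrtr_sqr ler_sqrt //.
exact: sqr_ge0.
Qed.

Lemma sqn_apply_le A v : sqn (applyX A v) <= (\sum_x sqn (A x)) * sqn v.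
Proof. by rewrite mulr_suml; apply: ler_sum => x _; exact: cauchy_schwarz. Qed.

Lemma vnorm0 : vnorm (fun _ : X => 0 : R[i]) = 0.
Proof.
rewrite vnormE /sqn big1 ?sqrtr0 // => x _.
by rewrite ComplexField.Normc.normc0 expr0n.
Qed.

(** * The operator norm and the Schur multiplier bound *)

Local Notation opset A :=
  [set r : R | exists v : vecX R X, vnorm v <= 1 /\ r = vnorm (applyX A v)]%classic.

(** The Hilbert-Schmidt norm is a bound, so the supremum defining [opnorm] is a genuine one. *)
Lemma opnorm_has_ub A : has_ubound (opset A).
Proof.
exists (Num.sqrt (\sum_x sqn (A x))) => _ [v [v1 ->]].
rewrite vnorm_le ?sqrtr_ge0 // sqr_sqrtr; last by apply: sumr_ge0 => x _; exact: sqn_ge0.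
apply: le_trans (sqn_apply_le _ _) _; rewrite ler_piMr //.
  by apply: sumr_ge0 => x _; exact: sqn_ge0.
by move: v1; rewrite vnorm_le // expr1n.
Qed.

Lemma opnorm_ub A v : vnorm v <= 1 -> vnorm (applyX A v) <= opnorm A.
Proof. by move=> v1; apply: (ub_le_sup (opnorm_has_ub A)); exists v. Qed.

Lemma opnorm_le A (c : R) :
  0 <= c -> (forall v, sqn (applyX A v) <= c ^+ 2 * sqn v) -> opnorm A <= c.
Proof.
move=> c0 Ac; apply: ge_sup.
  by exists (vnorm (applyX A (fun=> 0))); exists (fun=> 0); rewrite vnorm0 ler01.
move=> _ [v [v1 ->]]; rewrite vnorm_le //; apply: le_trans (Ac v) _.
by rewrite ler_piMr ?sqr_ge0 //; move: v1; rewrite vnorm_le // expr1n.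
Qed.

Lemma sqnZ (a : R) v : sqn (fun x => (a%:C)%C * v x) = a ^+ 2 * sqn v.
Proof.
rewrite /sqn mulr_sumr; apply: eq_bigr => x _.
by rewrite ComplexField.Normc.normcM exprMn /= [0 ^+ 2]expr0n addr0 sqrtr_sqr real_normK ?num_real.
Qed.

(** By homogeneity [v] can be rescaled to norm one; a vector of norm zero is covered by the
    Hilbert-Schmidt bound instead. *)
Lemma contraction_sqn A v : opnorm A <= 1 -> sqn (applyX A v) <= sqn v.
Proof.
move=> A1; have [v0|v0] := eqVneq (sqn v) 0.
  by apply: le_trans (sqn_apply_le _ _) _; rewrite v0 mulr0.
have vp : 0 < sqn v by rewrite lt_def v0 sqn_ge0.
pose a := (Num.sqrt (sqn v))^-1.
have a2 : a ^+ 2 = (sqn v)^-1 by rewrite exprVn sqr_sqrtr ?sqn_ge0.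
have : vnorm (applyX A (fun x => (a%:C)%C * v x)) <= 1.
  by apply: le_trans (opnorm_ub _ _) A1; rewrite vnorm_le // sqnZ a2 mulVf ?expr1n.
rewrite vnorm_le // expr1n.
have -> : applyX A (fun x => (a%:C)%C * v x) = fun x => (a%:C)%C * applyX A v x.
  by apply/funext => x; rewrite /applyX mulr_sumr; apply: eq_bigr => y _; rewrite mulrCA.
by rewrite sqnZ a2 mulrC ler_pdivrMr // mul1r.
Qed.

(* The easy half of Grothendieck's characterisation of Schur multipliers. *)
Lemma schur_factor_le (A B Rm : mxX R X) (c : R) :
  0 <= c -> (forall x, sqn (A x) <= c) -> (forall y, sqn (B ^~ y) <= c) ->
  opnorm Rm <= 1 -> opnorm (schur (mulX A B) Rm) <= c.
Proof.
move=> c0 Ac Bc R1; apply: opnorm_le => // v.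
(* [b z] is [v] weighted by row [z] of [B]. The Schur product applied to [v] becomes a sum over [z]
   of [A x z] times [Rm (b z)], to which Cauchy-Schwarz in [z] applies at each [x]. *)
pose b z : vecX R X := fun y => B z y * v y.
have e x : applyX (schur (mulX A B) Rm) v x = \sum_z A x z * applyX Rm (b z) x.
  rewrite /applyX /schur /mulX.
  under eq_bigr do rewrite -mulrA mulr_suml.
  rewrite exchange_big /=; apply: eq_bigr => z _.
  by rewrite mulr_sumr; apply: eq_bigr => y _; rewrite /b -!mulrA (mulrCA (B z y)).
apply: (@le_trans _ _ (\sum_x c * sqn (fun z => applyX Rm (b z) x))).
  apply: ler_sum => x _; rewrite e; apply: le_trans (cauchy_schwarz _ _) _.
  by rewrite ler_wpM2r ?sqn_ge0.
rewrite -mulr_sumr expr2 -mulrA ler_wpM2l // exchange_big /=.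
apply: (@le_trans _ _ (\sum_z sqn (b z))).
  by apply: ler_sum => z _; exact: contraction_sqn.
(* Summing over [z] first leaves each squared modulus of [v y] multiplied by the squared norm of
   column [y] of [B]. *)
rewrite exchange_big mulr_sumr /=; apply: ler_sum => y _.
under eq_bigr do rewrite ComplexField.Normc.normcM exprMn.
by rewrite -mulr_suml ler_wpM2r ?sqr_ge0 //; exact: Bc.
Qed.

End OperatorAlgebra.

(** * The spectral theorem for positive semidefinite matrices *)

Section Spectral.
Context {R : realType} {X : finType}.
Implicit Types (A B P T : mxX R X).

Let C := (R[i] : numClosedFieldType).

Definition ofM (M : 'M[R[i]]_#|X|) : mxX R X := fun x y => M (enum_rank x) (enum_rank y).

Lemma ofM_mul M N : ofM (M *m N) = mulX (ofM M) (ofM N).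
Proof.
apply: mxX_eq => x y; rewrite /ofM mxE /mulX.
by rewrite (reindex (@enum_rank X)) //=; apply: onW_bij; exact: enum_rank_bij.
Qed.

Lemma ofM1 : ofM 1%:M = idX.
Proof. by apply: mxX_eq => x y; rewrite /ofM mxE (inj_eq enum_rank_inj). Qed.

Local Open Scope sesquilinear_scope.

Lemma ofM_adj (M : 'M[C]_#|X|) : ofM (M^t*) = adjX (ofM M).
Proof. by apply: mxX_eq => x y; rewrite /ofM !mxE. Qed.

Lemma ofM_diag (d : 'rV[C]_#|X|) :
  ofM (diag_mx d) = diagX (fun x => d 0 (enum_rank x)).
Proof.
apply: mxX_eq => x y; rewrite /ofM mxE /diagX (inj_eq enum_rank_inj).
by case: (x == y); rewrite ?mul1r ?mul0r.
Qed.

Lemma psd_quad P V : psd P -> forall z, 0 <= mulX V (mulX P (adjX V)) z z.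
Proof.
move=> [_ P0] z; have := P0 (adjX V ^~ z).
congr (0 <= _); apply: eq_bigr => x _; rewrite mulr_sumr.
by apply: eq_bigr => y _; rewrite /adjX conjcK mulrA.
Qed.

(** The spectral theorem for normal matrices, carried over from ordinal indices by [enum_rank].
    Eigenvalues are nonnegative, hence real, which allows [d] to take values in [R]. *)
Lemma psd_spectral P : psd P ->
  exists (V : mxX R X) (d : X -> R), [/\ forall z, 0 <= d z,
    mulX (adjX V) V = idX, mulX V (adjX V) = idX &
    P = mulX (adjX V) (mulX (diagX (fun z => ((d z)%:C)%C)) V)].
Proof.
move=> psdP; have [Ph _] := psdP.
pose M : 'M[C]_#|X| := \matrix_(i, j) P (enum_val i) (enum_val j).
have MP : ofM M = P by apply: mxX_eq => x y; rewrite /ofM mxE !enum_rankK.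
have Mh : M \is hermsymmx.
  rewrite qualifE /= expr0 scale1r; apply/eqP/matrixP => i j.
  by rewrite !mxE Ph.
have := hermitian_normalmx Mh; move/orthomx_spectralP.
have Su := spectral_unitarymx M.
rewrite (invmx_unitary Su); set S := spectralmx M in Su *; set D := spectral_diag M => ME.
pose V := ofM S.
have V1 : mulX V (adjX V) = idX.
  by rewrite -ofM_adj -ofM_mul (unitarymxP Su) ofM1.
have V2 : mulX (adjX V) V = idX.
  rewrite -ofM_adj -ofM_mul -ofM1 -(invmx_unitary Su) mulVmx //.
  exact: unitarymx_unit.
have PE : P = mulX (adjX V) (mulX (diagX (fun x => D 0 (enum_rank x))) V).
  by rewrite -MP ME !ofM_mul ofM_adj ofM_diag mulXA.
(* The eigenvalues are the diagonal entries of [V P V^*], that is, values of the quadratic form of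
   [P]. *)
have D0 x : 0 <= D 0 (enum_rank x).
  have := @psd_quad P V psdP x; rewrite {1}PE -!mulXA V1 mulX1 mulXA V1 mul1X.
  by rewrite /diagX eqxx mul1r.
exists V, (fun x => complex.Re (D 0 (enum_rank x))); split=> //.
  by move=> z; have := D0 z; rewrite lecE => /andP[].
rewrite {1}PE; congr (mulX _ (mulX (diagX _) _)); apply/funext => x.
by rewrite RRe_real // ger0_real.
Qed.


Lemma psd_adj_mul A : psd (mulX (adjX A) A).
Proof.
split=> [x y|v]; last by rewrite -sqn_apply ler0c sqn_ge0.
by rewrite -[RHS]/(adjX _ x y) adjXM adjXK.
Qed.

(** * Functional calculus in a fixed orthonormal eigenbasis *)

Section FunctionalCalculus.
Context (V : mxX R X).
Hypotheses (VaV : mulX (adjX V) V = idX) (VVa : mulX V (adjX V) = idX).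
Implicit Types f g : X -> R[i].

(** The columns of [adjX V] are the eigenvectors, and [f z] is the eigenvalue on the one with index
    [z]. *)
Definition fcalc f : mxX R X := mulX (adjX V) (mulX (diagX f) V).

Lemma fcalcM f g : mulX (fcalc f) (fcalc g) = fcalc (fun z => f z * g z).
Proof.
rewrite /fcalc -!mulXA [mulX V (mulX _ _)]mulXA VVa mul1X.
by rewrite [mulX (diagX f) _]mulXA diagXM.
Qed.

Lemma fcalc_adj f : adjX (fcalc f) = fcalc (fun z => conjc (f z)).
Proof. by rewrite /fcalc !adjXM adjXK adjX_diag mulXA. Qed.

Lemma fcalcD f g x y : fcalc f x y + fcalc g x y = fcalc (fun z => f z + g z) x y.
Proof.
rewrite /fcalc /mulX -big_split /=; apply: eq_bigr => z _.
by rewrite -mulrDr -/(mulX _ _ z y) -/(mulX _ _ z y) -/(mulX _ _ z y) !mul_diagX mulrDl.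
Qed.

Lemma fcalc1 : fcalc (fun=> 1) = idX.
Proof.
rewrite /fcalc; have -> : diagX (fun=> 1) = idX :> mxX R X.
  by apply: mxX_eq => x y; rewrite /diagX mulr1.
by rewrite mul1X.
Qed.

(* On nonnegative reals squaring is injective, so a function of [d] is a
   function of [d ^+ 2]. *)
Lemma fcalc_comm (d : X -> R) (phi : R -> R) (W : mxX R X) :
  (forall z, 0 <= d z) ->
  mulX W (fcalc (fun z => ((d z ^+ 2)%:C)%C)) =
    mulX (fcalc (fun z => ((d z ^+ 2)%:C)%C)) W ->
  mulX W (fcalc (fun z => ((phi (d z))%:C)%C)) =
    mulX (fcalc (fun z => ((phi (d z))%:C)%C)) W.
Proof.
(* [W'] is [W] written in the eigenbasis, where functions of [d] are diagonal. *)
move=> d0; pose W' := mulX V (mulX W (adjX V)).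
have WE : W = mulX (adjX V) (mulX W' V).
  by rewrite /W' -!mulXA VaV mulX1 mulXA VaV mul1X.
have L f : mulX W (fcalc f) = mulX (adjX V) (mulX (mulX W' (diagX f)) V).
  by rewrite {1}WE /fcalc -!mulXA [mulX V (mulX (adjX V) _)]mulXA VVa mul1X.
have K f : mulX (fcalc f) W = mulX (adjX V) (mulX (mulX (diagX f) W') V).
  by rewrite {1}WE /fcalc -!mulXA [mulX V (mulX (adjX V) _)]mulXA VVa mul1X.
have J A : mulX V (mulX (mulX (adjX V) (mulX A V)) (adjX V)) = A.
  by rewrite -!mulXA VVa mulX1 mulXA VVa mul1X.
rewrite !L !K => /(congr1 (fun A => mulX V (mulX A (adjX V)))); rewrite !J => E.
congr (mulX _ (mulX _ _)); apply: mxX_eq => x y.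
have := congr1 (fun A => A x y) E; rewrite !mulX_diag !mul_diagX => {}E.
(* Commutation with the squares says [W' x y * d y ^+ 2 = d x ^+ 2 * W' x y]: either the entry
   vanishes or [d x = d y]. *)
have [->|Wxy] := eqVneq (W' x y) 0; first by rewrite mul0r mulr0.
suff -> : d x = d y by rewrite mulrC.
apply/eqP; rewrite -(@eqrXn2 _ 2) //; apply/eqP/complexI/(mulIf Wxy).
by rewrite -E mulrC.
Qed.

End FunctionalCalculus.

(** * Existence of the absolute value and the polar decomposition *)

Lemma absmx_exists T : exists P, is_absmx T P.
Proof.
have [V [d [d0 VaV VVa TE]]] := @psd_spectral (mulX (adjX T) T) (psd_adj_mul T).
(* The fourth root of [T^* T]: it exhibits the candidate for [|T|] as [Q^* Q], hence as positive
   semidefinite. *)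
pose Q := fcalc V (fun z => ((Num.sqrt (Num.sqrt (d z)))%:C)%C).
exists (fcalc V (fun z => ((Num.sqrt (d z))%:C)%C)); split.
  suff -> : fcalc V (fun z => ((Num.sqrt (d z))%:C)%C) = mulX (adjX Q) Q.
    exact: psd_adj_mul.
  rewrite /Q fcalc_adj fcalcM //; congr (fcalc V _); apply/funext => z.
  by rewrite conjc_real -rmorphM -expr2 sqr_sqrtr // sqrtr_ge0.
rewrite fcalcM // TE /fcalc; congr (mulX _ (mulX (diagX _) _)); apply/funext => z.
by rewrite -rmorphM -expr2 sqr_sqrtr.
Qed.

(* [U] is the partial isometry of the polar decomposition, [Q] the square root
   of [P] and [B] the projection on the kernel of [T]; the last clause puts [U]
   and [Q] in the bicommutant of [T]. *)
Lemma polar_decomposition T P : is_absmx T P ->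
  exists U Q B : mxX R X,
  [/\ adjX Q = Q, mulX Q Q = P, mulX U P = T & mulX (adjX U) T = P] /\
  (forall x y, mulX (adjX U) U x y + mulX (adjX B) B x y = idX x y) /\
  (forall W, mulX W T = mulX T W -> mulX W (adjX T) = mulX (adjX T) W ->
     mulX W Q = mulX Q W /\ mulX W U = mulX U W).
Proof.
move=> [psdP PPE]; have [V [d [d0 VaV VVa PE]]] := @psd_spectral P psdP.
pose F (phi : R -> R) := fcalc V (fun z => ((phi (d z))%:C)%C).
have FE phi psi : (forall t, 0 <= t -> phi t = psi t) -> F phi = F psi.
  by move=> e; congr (fcalc V _); apply/funext => z; rewrite e.
have FM phi psi : mulX (F phi) (F psi) = F (fun t => phi t * psi t).
  by rewrite /F fcalcM //; congr (fcalc V _); apply/funext => z; rewrite rmorphM.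
have FA phi : adjX (F phi) = F phi.
  by rewrite /F fcalc_adj; congr (fcalc V _); apply/funext => z; rewrite conjc_real.
have {}PE : P = F id by [].
have TTE : mulX (adjX T) T = F (fun t => t ^+ 2) by rewrite -PPE PE FM; exact: FE.
pose B := F (fun t => (t == 0)%:R).
(* Since [0^-1 = 0], this is the pseudo-inverse of [P]: [K P] is the projection complementary to
   [B]. *)
pose K := F (fun t => t^-1).
(* [(T B)^* (T B) = B P^2 B], and the function [t ^+ 2] vanishes where the indicator of zero does
   not. *)
have TB : mulX T B = fun _ _ => 0.
  apply: adj_mul_eq0; rewrite adjXM -mulXA [mulX (adjX T) _]mulXA TTE FA !FM.
  rewrite (FE _ (fun=> 0)); last first.
    by move=> t _; have [->|] := eqVneq t 0; rewrite ?expr0n ?mul0r ?mulr0.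
  apply: mxX_eq => x y; rewrite /F /fcalc /mulX big1 // => z _.
  by rewrite -/(mulX _ _ z y) mul_diagX rmorph0 mul0r mulr0.
have KP : forall x y, mulX K P x y + B x y = idX x y.
  move=> x y; rewrite PE FM fcalcD -(fcalc1 VaV); congr (fcalc V _ x y).
  apply/funext => z; rewrite -rmorphD /=.
  have [->|dz] := eqVneq (d z) 0; first by rewrite invr0 mul0r add0r rmorph1.
  by rewrite mulVf // addr0 rmorph1.
exists (mulX T K), (F Num.sqrt), B; split; [split|split].
- exact: FA.
- by rewrite FM PE; apply: FE => t t0; rewrite -expr2 sqr_sqrtr.
(* [T = T (K P + B) = T K P], because [T B = 0]. *)
- rewrite -mulXA -[RHS](mulX1 T); apply: mxX_eq => x y.
  rewrite -[LHS]addr0 -[X in _ + X]/((fun _ _ : X => 0) x y) -TB /mulX -big_split /=.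
  by apply: eq_bigr => z _; rewrite -mulrDr KP.
- rewrite adjXM -mulXA TTE FA FM PE; apply: FE => t t0.
  have [->|tn0] := eqVneq t 0; first by rewrite expr0n mulr0.
  by rewrite expr2 mulrA mulVf // mul1r.
- move=> x y; rewrite adjXM -mulXA [mulX (adjX T) _]mulXA TTE !FA !FM.
  rewrite -(KP x y) PE FM; congr (_ + _); apply: (congr1 (fun A => A x y)); apply: FE => t t0.
    have [->|tn0] := eqVneq t 0; first by rewrite invr0 !mul0r.
    by rewrite expr2 -mulrA divff // mulr1.
  by case: (t == 0); rewrite ?mulr1 ?mulr0.
- move=> W WT WTa.
  (* [W] commutes with [T^* T = P^2], hence with every function of [P]. *)
  have comm phi : mulX W (F phi) = mulX (F phi) W.
    apply: fcalc_comm => //; rewrite -[fcalc _ _]/(F (fun t => t ^+ 2)) -TTE.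
    by rewrite mulXA WTa -mulXA WT mulXA.
  by split; rewrite ?comm // mulXA WT -mulXA comm mulXA.
Qed.

End Spectral.

(** * The commutant of a permutation representation *)

Section Commutant.
Context {R : realType} {gT : finGroupType} {G : {group gT}} {X : finType}.
Context (to : action G X).
Implicit Types A B : mxX R X.

(** Multiplying by a permutation matrix only relabels one index, so the commutant consists of the
    matrices constant on orbits of [G] on pairs. *)
Lemma commutantP A : commutant to A <->
  (forall g, g \in G -> forall x y, A (to x g) (to y g) = A x y).
Proof.
have L g x y : mulX A (permrep R to g) x y = A x (to y g).
  by rewrite /mulX /permrep sum_deltar.
have K g x y : mulX (permrep R to g) A (to x g) y = A x y.
  rewrite /mulX /permrep; under eq_bigr do rewrite (inj_eq (act_inj to g)).
  by rewrite sum_deltal.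
split=> [cA g gG x y|cA g gG].
  by rewrite -L cA // K.
apply: mxX_eq => x y; rewrite -[x](actKVin to gG) L K.
by rewrite cA.
Qed.

Lemma commutant_mul A B : commutant to A -> commutant to B -> commutant to (mulX A B).
Proof. by move=> cA cB g gG; rewrite -mulXA cB // mulXA cA // mulXA. Qed.

Lemma commutant_adj A : commutant to A -> commutant to (adjX A).
Proof.
by move=> /commutantP cA; apply/commutantP => g gG x y; rewrite /adjX cA.
Qed.

(** Under transitivity the diagonal of [X * X] is a single orbit. *)
Lemma commutant_diag A : [transitive G, on [set: X] | to] ->
  commutant to A -> forall x y, A x x = A y y.
Proof.
move=> tr /commutantP cA x y.
have [z _ orbz] := imsetP tr.
have Az t : A t t = A z z.
  by have /imsetP[g gG ->] : t \in orbit to G z; [rewrite -orbz inE | exact: cA].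
by rewrite !Az.
Qed.

Lemma commutant_trace A : [transitive G, on [set: X] | to] ->
  commutant to A -> forall x, traceX A = #|X|%:R * A x x.
Proof.
move=> tr cA x; rewrite /traceX (eq_bigr (fun=> A x x)); last first.
  by move=> y _; exact: commutant_diag.
by rewrite sumr_const mulr_natl.
Qed.

End Commutant.

(** The upper bound holds for all contractions and is attained at one in the commutant, so both
    suprema equal the same [c]. *)
Lemma schur_norms_commutant (R : realType) (gT : finGroupType) (G : {group gT})
  (X : finType) (to : action G X) (T P : mxX R X) (x0 : X) :
  [transitive G, on [set: X] | to] -> commutant to T -> is_absmx T P ->
  exists c : R, [/\ schur_norm T = c,
    schur_norm_on (commutant (R := R) to) T = c,
    P x0 x0 = (c%:C)%C & (#|X|%:R)^-1 * traceX P = (c%:C)%C].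
Proof.
move=> tr cT absP.
have [U [Q [B [[Qa QQ UP UT] [UB comm]]]]] := polar_decomposition absP.
have cTa := commutant_adj cT.
have cQ : commutant to Q.
  by move=> g gG; have [-> _] := comm _ (esym (cT g gG)) (esym (cTa g gG)).
have cU : commutant to U.
  by move=> g gG; have [_ ->] := comm _ (esym (cT g gG)) (esym (cTa g gG)).
have cP : commutant to P by rewrite -QQ; exact: commutant_mul.
have cUPU : commutant to (mulX T (adjX U)).
  by apply: commutant_mul => //; exact: commutant_adj.
have n0 : #|X|%:R != 0 :> R[i] by rewrite pnatr_eq0 -lt0n; apply/card_gt0P; exists x0.
have UPU x : mulX T (adjX U) x x = P x0 x0.
  apply: (mulfI n0); rewrite -(commutant_trace tr cUPU) -(commutant_trace tr cP).
  by rewrite traceXC UT.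
(* As [P = Q^* Q], the entry [P x0 x0] is a squared column norm; this yields [c] as a nonnegative
   element of [R]. *)
pose c := sqn (Q ^~ x0).
have cE : P x0 x0 = (c%:C)%C by rewrite sqn_col Qa QQ.
have c0 : 0 <= c := sqn_ge0 _.
have upper Rm : opnorm Rm <= 1 -> opnorm (schur T Rm) <= c.
  move=> R1; rewrite -UP -QQ mulXA; apply: schur_factor_le => // [x|y].
    rewrite -lecR sqn_row adjXM Qa -mulXA [mulX Q _]mulXA QQ mulXA UP.
    by rewrite UPU cE.
  by rewrite -lecR sqn_col Qa QQ (commutant_diag tr cP y x0) cE.
(* The conjugate makes the row sums of [schur T Uc] the diagonal entries of [T U^*], all equal to
   [c]. *)
pose Uc : mxX R X := fun x y => conjc (U x y).
have cUc : commutant to Uc.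
  by apply/commutantP => g gG x y; rewrite /Uc (commutantP _ _).1.
have Uc1 : opnorm Uc <= 1.
  apply: opnorm_le => // v; rewrite expr1n mul1r.
  pose w : vecX R X := fun x => conjc (v x).
  have conj_sqn (u : vecX R X) : sqn (fun x => conjc (u x)) = sqn u.
    by apply: complexI; rewrite !sqnE; apply: eq_bigr => x _; rewrite conjcK mulrC.
  have -> : applyX Uc v = fun x => conjc (applyX U w x).
    apply/funext => x; rewrite /applyX rmorph_sum /=; apply: eq_bigr => y _.
    by rewrite rmorphM /= conjcK.
  by rewrite conj_sqn -(conj_sqn v) -(sqn_applyD w UB) lerDl sqn_ge0.
have lower : opnorm (schur T Uc) = c.
  apply/eqP; rewrite eq_le upper //=.
  have nR0 : (#|X|%:R : R) != 0 by rewrite pnatr_eq0 -lt0n; apply/card_gt0P; exists x0.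
  (* Normalises the constant vector [w] to norm one. *)
  pose a : R := (Num.sqrt #|X|%:R)^-1.
  have a2 : a ^+ 2 = (#|X|%:R)^-1 by rewrite exprVn sqr_sqrtr ?ler0n.
  pose w : vecX R X := fun=> (a%:C)%C.
  have w1 : sqn w = 1.
    apply: complexI; rewrite sqnE (eq_bigr (fun=> ((a ^+ 2)%:C)%C)).
      by rewrite sumr_const -mulr_natl a2 -(rmorph_nat (real_complex R)) -rmorphM mulfV.
    by move=> x _; rewrite conjc_real -rmorphM.
  have vw : vnorm (applyX (schur T Uc) w) = c.
    have -> : applyX (schur T Uc) w = fun x => (c%:C)%C * w x.
      by apply/funext => x; rewrite -cE -(UPU x) mulr_suml.
    by rewrite vnormE sqnZ w1 mulr1 sqrtr_sqr ger0_norm.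
  by rewrite -{1}vw opnorm_ub // vnorm_le // w1 expr1n.
exists c; split=> //; last by rewrite (commutant_trace tr cP x0) mulrA mulVf ?mul1r.
- apply/eqP; rewrite eq_le; apply/andP; split.
    apply: ge_sup; first by exists c; exists Uc; rewrite lower.
    by move=> _ [Rm [R1 ->]]; exact: upper.
  apply: ub_le_sup; last by exists Uc; rewrite lower.
  by exists c => _ [Rm [R1 ->]]; exact: upper.
- apply/eqP; rewrite eq_le; apply/andP; split.
    apply: ge_sup; first by exists c; exists Uc; rewrite lower.
    by move=> _ [Rm [_ [R1 ->]]]; exact: upper.
  apply: ub_le_sup; last by exists Uc; rewrite lower.
  by exists c => _ [Rm [_ [R1 ->]]]; exact: upper.
Qed.

Theorem theorem4p4 (R : realType) (gT : finGroupType) (G : {group gT})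
  (X : finType) (to : action G X)
  (Htrans : [transitive G, on [set: X] | to])
  (T : mxX R X) (HT : commutant to T) (x0 : X) :
  schur_norm T = schur_norm_on (@commutant R gT G X to) T /\
  (forall P : mxX R X, is_absmx T P ->
     ((schur_norm T)%:C)%C = (#|X|%:R)^-1 * traceX P /\
     ((schur_norm T)%:C)%C = P x0 x0).
Proof.
split=> [|P absP].
  (* This equality mentions no [P], so an absolute value has to be supplied. *)
  have [P absP] := absmx_exists T.
  by have [c [-> -> _ _]] := schur_norms_commutant x0 Htrans HT absP.
by have [c [-> _ -> ->]] := schur_norms_commutant x0 Htrans HT absP.
Qed.
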